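(* Let $g\in S^2\mathbb{C}^3$ be an arbitrary nonzero ternary quadratic form over $\mathbb{C}$ (a homogeneous polynomial of degree $2$ in three variables), and denote by $\operatorname{rk} g$ its rank. For every $s\in\mathbb{N}$, if $g$ is degenerate (that is, $\operatorname{rk} g<3$), then \[ \operatorname{brk}(g^s)=\operatorname{rk}(g^s)=\binom{s+\operatorname{rk} g-1}{\operatorname{rk} g-1}. \] Otherwise (that is, if $g$ is non-degenerate), \[ \operatorname{brk}(g^s)=\binom{s+2}{2}=\frac{(s+1)(s+2)}{2}. \]
   Context: $\mathbb{N}=\{0,1,2,\dots\}$. For a homogeneous polynomial $f$ of degree $d$ in $n$ variables over $\mathbb{C}$, the (Waring, or symmetric) rank $\operatorname{rk}(f)$ is the minimum integer $r$ such that $f=\ell_1^d+\dots+\ell_r^d$ for some linear forms $\ell_1,\dots,\ell_r$ with complex coefficients. The border rank $\operatorname{brk}(f)$ is the minimum integer $r$ such that $f$ is a limit, in the finite-dimensional complex vector space of homogeneous polynomials of degree $d$ in these variables, of polynomials of rank at most $r$. For a quadratic form $g$, $\operatorname{rk} g$ coincides with the rank of its associated symmetric matrix. *)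

(* Defs.v *)
From mathcomp Require Import all_boot all_order all_algebra.
From mathcomp Require Import complex mpoly.
From mathcomp Require Import all_classical reals topology normedtype.

Set Implicit Arguments.
Unset Strict Implicit.
Unset Printing Implicit Defensive.

Import Order.TTheory GRing.Theory Num.Theory.
Import numFieldNormedType.Exports.
Local Open Scope classical_set_scope.
Local Open Scope ring_scope.

(* Viewing R[i] as an abstract number field gives it its normed topology. *)
Definition Cplx (R : realType) : numClosedFieldType := R[i].

(* The value is 0 when P is empty. *)
Definition minimum (P : set nat) : nat :=
  xget 0%N [set r | P r /\ forall k, P k -> (r <= k)%N].

Lemma minimumP (P : set nat) (k : nat) :
  P k -> P (minimum P) /\ (minimum P <= k)%N.
Proof.
move=> Pk; have exP : exists j, `[< P j >] by exists k; apply/asboolP.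
suff [Pm min_m] : [set r | P r /\ forall k, P k -> (r <= k)%N] (minimum P).
  by split => //; exact: min_m.
apply: xgetPex; case: (ex_minnP exP) => m /asboolP Pm min_m.
by exists m; split => // j Pj; apply: min_m; apply/asboolP.
Qed.

(* d is a parameter because the zero polynomial is homogeneous of every degree. *)
Definition waring_decomp (R : realType) (n d : nat)
    (f : {mpoly (Cplx R)[n]}) (r : nat) : Prop :=
  exists2 l : 'I_r -> {mpoly (Cplx R)[n]},
    forall i, l i \is 1.-homog & f = \sum_(i < r) l i ^+ d.

Definition rk (R : realType) (n d : nat) (f : {mpoly (Cplx R)[n]}) : nat :=
  minimum (waring_decomp d f).

(* Stated through decompositions rather than as rk d f <= r: in degree 0 a
   constant outside of nat has no decomposition, and rk is then 0 by
   convention. *)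
Definition rk_le (R : realType) (n d : nat) (f : {mpoly (Cplx R)[n]})
    (r : nat) : Prop :=
  exists2 k, (k <= r)%N & waring_decomp d f k.

(* Sums of d-th powers of linear forms are d-homogeneous, and the topology of
   the finite-dimensional space of d-homogeneous polynomials is that of
   coefficientwise convergence. *)
Definition border_rk_le (R : realType) (n d : nat) (f : {mpoly (Cplx R)[n]})
    (r : nat) : Prop :=
  exists2 u : nat -> {mpoly (Cplx R)[n]},
    forall k, rk_le d (u k) r
    & forall m : 'X_{1..n}, (fun k => (u k)@_m) @ \oo --> f@_m.

Definition brk (R : realType) (n d : nat) (f : {mpoly (Cplx R)[n]}) : nat :=
  minimum (border_rk_le d f).

(* Main.v *)
Require Import Defs.
From mathcomp Require Import all_boot all_order all_algebra.
From mathcomp Require Import separable cyclotomic ring zify.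
From mathcomp Require Import complex mpoly.
From mathcomp Require Import all_classical reals topology normedtype.

(** The number to be reached is the dimension of the space of forms of degree s
in rk g variables, and it is reached from both sides.

After diagonalisation g = l_1^2 + ... + l_k^2 with independent linear forms
([quad_diag]).  Substituting linear forms for the variables does not increase
rank or border rank ([waring_comp], [border_comp]), so g may be replaced by any
equivalent quadric, in k variables, whichever is convenient.

Lower bound ([border_sumsq], [border_gram]).  The middle catalecticant of a sum
of r powers of linear forms has rank at most r, and this survives limits, as
minors are continuous.  The catalecticant of (x_1^2 + ... + x_k^2)^s is, up to a
scalar, the Gram matrix of the monomials of degree s for a product of standard
Gaussian measures, because the moments of the latter are the coefficients of
that power; expanding the monomials in Hermite polynomials shows that it is
positive definite.

Upper bound.  For k = 2 the form is (x y)^s, and s + 1 powers (x + z y)^(2 s),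
where z ranges over the roots of unity of order s + 1, suffice.  For k = 3 the
form is (y^2 + 2 x z)^s.  A sum of N powers with coefficients c_i of linear forms
x_i x + y_i y + z is, coefficient by coefficient, the functional
p |-> sum_i c_i p(x_i, y_i) on polynomials of degree at most 2 s, so the task is
to approximate by N = (s + 1)(s + 2) / 2 nodes the functional L which the form
defines; L is nonzero only on the monomials x^a y^b with 2 a + b = 2 s.  The
torus (t x, y, z / t) fixes the form, and t -> 0 kills the monomials with
2 a + b > 2 s, so it is enough to agree with L when 2 a + b <= 2 s
([cubature], [border_conic]).

Such a cubature rule exists for the following reason.  The functional L
vanishes on the ideal of the harmonic forms of degree s + 1 of nonnegative
weight: x^(s+1-n) P_n(x, y) for n = 0, ..., s + 1, where the P_n are Legendre
polynomials linked by P_(n+2) = y P_(n+1) - c_n x P_n.  This ideal has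
colength N, with the monomials of degree at most s as a basis of the quotient,
but all of its zeros lie at one point.  The recurrence suggests how to spread
them: replacing x by x - n in its n-th step and x^(s+1-n) by the product of the
x - j for n <= j <= s yields curves whose leading parts, for the grading
2 a + b of x^a y^b, are the previous ones, and which pass through the j + 1 zeros of P_(j+1)(j, y) on each of the
lines x = j, 0 <= j <= s.  These zeros are distinct, P_0(j, y), ..., P_(j+1)(j, y)
being orthogonal polynomials ([favard_roots]).  Any functional can be
interpolated at the N nodes on the monomials of degree at most s
([lines_interp]), and the curves propagate the equality to all monomials with
2 a + b <= 2 s. *)

Set Implicit Arguments.
Unset Strict Implicit.
Unset Printing Implicit Defensive.

Import Order.TTheory GRing.Theory Num.Theory.
Import numFieldNormedType.Exports.
Local Open Scope classical_set_scope.
Local Open Scope ring_scope.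

(** * The apolar pairing with monomials *)

(** The moments of the standard Gaussian law. *)
Fixpoint gauss_mom (n : nat) : nat :=
  match n with 0 => 1 | 1 => 0 | n'.+2 => (n'.+1 * gauss_mom n')%N end.

Lemma gauss_momSS k : gauss_mom k.+2 = (k.+1 * gauss_mom k)%N. Proof. by []. Qed.

Lemma submUK n (m : 'X_{1..n}) i : (0 < m i)%N -> (m - U_(i) + U_(i))%MM = m.
Proof.
move=> mi; rewrite submK //; apply/mnm_lepP => j; rewrite mnm1E.
by case: eqVneq => [<-|].
Qed.

Lemma mdegBU n (m : 'X_{1..n}) i : (0 < m i)%N -> (mdeg (m - U_(i))).+1 = mdeg m.
Proof. by move=> mi; rewrite -{2}(submUK mi) mdegD mdeg1 addn1. Qed.

Lemma mfact_neq0 (K : numDomainType) n (m : 'X_{1..n}) :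
  (\prod_(i < n) (m i)`!)%:R != 0 :> K.
Proof. by rewrite pnatr_eq0 -lt0n prodn_gt0 // => i; exact: fact_gt0. Qed.

Section Apolar.
Variables (F : comNzRingType) (n : nat).
Implicit Types (m : 'X_{1..n}) (f : {mpoly F[n]}).

(** The factorials make multiplication by a variable adjoint to differentiation
of the monomial ([apolarXM]), and the pairing with the power of a linear form
an evaluation at its coefficients ([apolar_linform]). *)
Definition apolar m f : F := (\prod_(i < n) (m i)`!)%:R * f@_m.

Lemma mcoeffXM m i f :
  ('X_i * f)@_m = if (0 < m i)%N then f@_(m - U_(i)) else 0.
Proof.
case: ifPn => [mi|mi].
  by rewrite mulrC -{1}(submUK mi) addmC mcoeffMX.
rewrite mulrC (mpolyE f) mulr_suml raddf_sum big1 // => k _ /=.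
rewrite -scalerAl mcoeffZ -mpolyXD mcoeffX; case: eqP => [e|_]; last by rewrite mulr0.
by move: mi; rewrite -e mnmDE mnm1E eqxx addn1.
Qed.

Lemma apolarXM m i f : apolar m ('X_i * f) = (m i)%:R * apolar (m - U_(i)) f.
Proof.
rewrite /apolar mcoeffXM; case: ifPn => [mi|]; last first.
  by rewrite -eqn0Ngt => /eqP ->; rewrite mulr0 mul0r.
rewrite mulrA -natrM; congr (_%:R * _).
rewrite (bigD1 i) //= [in RHS](bigD1 i) //= mulnA; congr (_ * _)%N.
  by rewrite mnmBE mnm1E eqxx -[in LHS](prednK mi) factS prednK // subn1.
by apply: eq_bigr => j ji; rewrite mnmBE mnm1E eq_sym (negPf ji) subn0.
Qed.

Lemma apolarZ m c f : apolar m (c *: f) = c * apolar m f.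
Proof. by rewrite /apolar mcoeffZ mulrCA. Qed.

Lemma apolar_sum m (I : Type) (r : seq I) (P : pred I) (f : I -> {mpoly F[n]}) :
  apolar m (\sum_(i <- r | P i) f i) = \sum_(i <- r | P i) apolar m (f i).
Proof. by rewrite /apolar raddf_sum mulr_sumr. Qed.

Lemma apolarD m f g : apolar m (f + g) = apolar m f + apolar m g.
Proof. by rewrite /apolar mcoeffD mulrDr. Qed.

Lemma apolar1 m : mdeg m = 0%N -> apolar m 1 = 1.
Proof.
move/eqP; rewrite mdeg_eq0 => /eqP ->; rewrite /apolar mcoeff1 eqxx mulr1.
by rewrite big1 // => i _; rewrite mnm0E.
Qed.

Lemma prodB1 (c : 'I_n -> nat -> F) m i :
  \prod_j c j ((m - U_(i))%MM j) = c i (m i).-1 * \prod_(j | j != i) c j (m j).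
Proof.
rewrite (bigD1 i) //= mnmBE mnm1E eqxx subn1; congr (_ * _).
by apply: eq_bigr => j ji; rewrite mnmBE mnm1E eq_sym (negPf ji) subn0.
Qed.

Definition linform (v : 'I_n -> F) : {mpoly F[n]} := \sum_i v i *: 'X_i.

Lemma linform_homog v : linform v \is 1.-homog.
Proof. by apply: rpred_sum => i _; apply: rpredZ; rewrite /= dhomogX; apply/eqP/mdeg1. Qed.

Lemma homog1_linform (l : {mpoly F[n]}) : l \is 1.-homog ->
  l = linform (fun i => l@_U_(i)).
Proof.
move=> lh; apply/mpolyP => m; rewrite /linform raddf_sum /=.
under eq_bigr => i _ do rewrite mcoeffZ mcoeffX.
have [|m1] := boolP (mdeg m == 1%N).
  case/mdeg1P => i /eqP ->.
  rewrite (bigD1 i) //= eqxx mulr1 big1 ?addr0 // => j ji.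
  by case: eqP => [/eqP|]; rewrite ?mulr0 // eq_mnm1 (negPf ji).
rewrite (dhomog_nemf_coeff lh m1) big1 // => i _.
case: (U_(i)%MM =P m) m1 => [<-|]; last by rewrite mulr0.
by rewrite mdeg1.
Qed.

Lemma linform_comp p v (t : n.-tuple {mpoly F[p]}) :
  linform v \mPo t = \sum_i v i *: tnth t i.
Proof.
rewrite /linform raddf_sum; apply: eq_bigr => i _ /=.
by rewrite comp_mpolyZ comp_mpolyXU -tnth_nth.
Qed.

Lemma apolar_linform v d m : mdeg m = d ->
  apolar m (linform v ^+ d) = d`!%:R * \prod_i v i ^+ m i.
Proof.
elim: d m => [|d IH] m md.
  rewrite expr0 apolar1 // big1 ?mulr1 // => i _.
  by move/eqP: md; rewrite mdeg_eq0 => /eqP ->; rewrite mnm0E.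
rewrite exprS mulr_suml apolar_sum.
rewrite (eq_bigr (fun i => (m i)%:R * (d`!%:R * \prod_i v i ^+ m i))).
  by rewrite -mulr_suml -natr_sum -mdegE md factS natrM mulrA.
move=> i _; rewrite -scalerAl apolarZ apolarXM.
have [mi|] := posnP (m i); first by rewrite mi !mul0r mulr0.
move=> mi; rewrite IH; last by apply: succn_inj; rewrite mdegBU.
rewrite (prodB1 (fun j k => v j ^+ k)) [in RHS](bigD1 i) //= -[in v i ^+ m i](prednK mi) exprS.
by ring.
Qed.

Definition sumsq : {mpoly F[n]} := \sum_i 'X_i ^+ 2.

(** Both sides satisfy the recursion coming from one more factor: the factor
[m i * (m i - 1)] of the second derivative turns the moment of order [m i - 2]
into [m i] times that of order [m i], and the [m i] add up to the degree. *)
Lemma apolar_sumsq s m : mdeg m = (2 * s)%N ->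
  apolar m (sumsq ^+ s) = (2 ^ s * s`!)%:R * \prod_i (gauss_mom (m i))%:R.
Proof.
elim: s m => [|s IH] m md.
  rewrite expr0 apolar1 // big1 ?mulr1 // => i _.
  by move/eqP: md; rewrite mdeg_eq0 => /eqP ->; rewrite mnm0E.
rewrite exprS mulr_suml apolar_sum.
rewrite (eq_bigr (fun i => (m i)%:R * ((2 ^ s * s`!)%:R * \prod_i (gauss_mom (m i))%:R))).
  rewrite -mulr_suml -natr_sum -mdegE md mulrA -natrM; congr (_%:R * _).
  by rewrite factS expnS; lia.
move=> i _; rewrite expr2 -mulrA !apolarXM mnmBE mnm1E eqxx.
have [mi|m0] := posnP (m i); first by rewrite mi !mul0r.
have [mi|m1] := posnP (m i - 1).
  rewrite mi !mul0r mulr0 (bigD1 i) //=.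
  by rewrite (_ : m i = 1%N); [rewrite !mul0r !mulr0 | lia].
have m1' : (0 < (m - U_(i))%MM i)%N by rewrite mnmBE mnm1E eqxx.
rewrite IH; last by apply: succn_inj; apply: succn_inj; rewrite !mdegBU // md; lia.
rewrite (prodB1 (fun _ k => (gauss_mom k)%:R)).
rewrite [in RHS](bigD1 i) //= mnmBE mnm1E eqxx.
have -> : gauss_mom (m i) = ((m i - 1) * gauss_mom (m i - 1).-1)%N.
  by case: (m i) m0 m1 => [|[|k]] //; rewrite subn1.
rewrite natrM.
rewrite (eq_bigr (fun j => (gauss_mom (m j))%:R)); first by ring.
by move=> j ji; rewrite mnmBE mnm1E eq_sym (negPf ji) subn0.
Qed.
End Apolar.

Section Ternary.
Variable F : comNzRingType.

(** The ternary quadric in the coordinates (x, y, z) in which a torus fixing it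
acts diagonally, by (t, 1, 1 / t). *)
Definition conic : {mpoly F[3]} :=
  'X_(inord 1) ^+ 2 + 2 *: ('X_(inord 0) * 'X_(inord 2)).

(** The moment of x^a y^b z^c when y is a standard real Gaussian variable and x,
z are conjugate complex Gaussian variables. *)
Definition conic_mom (a b c : nat) : nat := if a == c then a`! * gauss_mom b else 0.

Lemma apolar_conic s (m : 'X_{1..3}) : mdeg m = (2 * s)%N ->
  apolar m (conic ^+ s) =
    (2 ^ s * s`! * conic_mom (m (inord 0)) (m (inord 1)) (m (inord 2)))%:R.
Proof.
have ne01 : (inord 0 == inord 1 :> 'I_3) = false by apply/eqP=> /(congr1 val) /=; rewrite !inordK.
have ne02 : (inord 0 == inord 2 :> 'I_3) = false by apply/eqP=> /(congr1 val) /=; rewrite !inordK.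
have ne12 : (inord 1 == inord 2 :> 'I_3) = false by apply/eqP=> /(congr1 val) /=; rewrite !inordK.
elim: s m => [|s IH] m md.
  rewrite expr0 apolar1 //.
  by move/eqP: md; rewrite mdeg_eq0 => /eqP ->; rewrite !mnm0E.
rewrite exprS mulrDl apolarD expr2 -mulrA -scalerAl -mulrA apolarZ !apolarXM.
have md3 : (m (inord 0) + m (inord 1) + m (inord 2))%N = (2 * s.+1)%N.
  rewrite -md mdegE !big_ord_recl big_ord0 addn0 addnA.
  by congr (m _ + m _ + m _)%N; apply: val_inj; rewrite /= inordK.
rewrite !mnmBE !mnm1E !eqxx ne02 !subn0.
have [a aE] : {a | m (inord 0) = a} by exists (m (inord 0)).
have [b bE] : {b | m (inord 1) = b} by exists (m (inord 1)).
have [c cE] : {c | m (inord 2) = c} by exists (m (inord 2)).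
rewrite aE bE cE in md3 *.
have -> : b%:R * ((b - 1%N)%:R * apolar (m - U_(inord 1) - U_(inord 1)) (conic ^+ s)) =
          (b * (2 ^ s * s`! * conic_mom a b c))%:R.
  rewrite natrM; have [->|b0] := posnP b; first by rewrite !mul0r.
  have [b1|b1] := posnP (b - 1); last first.
    have b1' : (0 < (m - U_(inord 1))%MM (inord 1))%N by rewrite mnmBE mnm1E eqxx bE.
    rewrite IH; last by apply: succn_inj; apply: succn_inj; rewrite !mdegBU ?bE // md; lia.
    rewrite !mnmBE !mnm1E !eqxx [inord 1 == inord 0]eq_sym ne01 ne12 !subn0 aE bE cE.
    rewrite -natrM; congr (_ * _%:R); rewrite /conic_mom; case: eqP => _; last by lia.
    case: (b) b0 b1 => [|[|k]] // _ _; rewrite gauss_momSS !subn1 /=; lia.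
  rewrite b1 mul0r /conic_mom; have -> : b = 1%N by lia.
  by case: ifP => _; rewrite /= !(muln0, mulr0).
have -> : a%:R * (c%:R * apolar (m - U_(inord 0) - U_(inord 2)) (conic ^+ s)) =
          (a * (2 ^ s * s`! * conic_mom a b c))%:R.
  rewrite natrM; have [->|a0] := posnP a; first by rewrite !mul0r.
  have [c0|c0] := posnP c.
    by rewrite c0 mul0r /conic_mom ifN ?muln0 // -lt0n.
  have c0' : (0 < (m - U_(inord 0))%MM (inord 2))%N by rewrite mnmBE mnm1E ne02 subn0 cE.
  rewrite IH; last by apply: succn_inj; apply: succn_inj; rewrite !mdegBU ?aE // md; lia.
  rewrite !mnmBE !mnm1E !eqxx ![inord 2 == _]eq_sym ne01 ne02 ne12 !subn0 aE bE cE.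
  rewrite -natrM; congr (_ * _%:R); rewrite /conic_mom.
  have -> : (a - 1 == c - 1)%N = (a == c) by apply/eqP/eqP; lia.
  case: eqP => [<-|_]; last by lia.
  by case: (a) a0 => // k _; rewrite factS subn1 /=; lia.
rewrite -natrM -natrD; congr (_%:R); rewrite expnS factS /conic_mom.
case: eqP => [ac|_]; last by lia.
rewrite -ac in md3.
have -> : b = (2 * s.+1 - 2 * a)%N by lia.
by nia.
Qed.
End Ternary.

(** * Nondegeneracy of the catalecticant *)

(** The coefficient of the j-th monic Hermite polynomial in the power x^a. *)
Definition hermite (a j : nat) : nat := 'C(a, j) * gauss_mom (a - j).

Lemma hermite0 a : hermite a 0 = gauss_mom a.
Proof. by rewrite /hermite bin0 mul1n subn0. Qed.

Lemma hermite_diag a : hermite a a = 1%N.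
Proof. by rewrite /hermite binn subnn. Qed.

Lemma hermite_small a j : (a < j)%N -> hermite a j = 0%N.
Proof. by move=> ?; rewrite /hermite bin_small. Qed.

Lemma hermiteS0 a : hermite a.+1 0 = hermite a 1.
Proof. by rewrite hermite0 /hermite bin1; case: a => // a; rewrite gauss_momSS subn1. Qed.

Lemma hermiteSS a j : hermite a.+1 j.+1 = (hermite a j + j.+2 * hermite a j.+2)%N.
Proof.
rewrite /hermite binS subSS mulnDl addnC; congr (_ + _)%N.
rewrite mulnA (mul_bin_left a j.+1).
have [aj|ja] := ltnP a j.+1; first by rewrite bin_small ?muln0.
have -> : (a - j = (a - j.+1).+1)%N by lia.
case E : (a - j.+1)%N => [|k]; first by rewrite !mul0n muln0.
rewrite gauss_momSS (_ : (a - j.+2 = k)%N); lia.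
Qed.

(** The Gaussian scalar product of x^a and x^b, computed from their Hermite
expansions; the sum is cut at K, beyond which all terms vanish. *)
Definition wick K a b : nat := \sum_(j < K) j`! * (hermite a j * hermite b j).

Lemma wickS K a b : (a < K)%N -> wick K.+1 a.+1 b =
  (\sum_(j < K) j.+1`! * (hermite a j * hermite b j.+1) +
   \sum_(j < K) j.+1`! * (hermite a j.+1 * hermite b j))%N.
Proof.
move=> aK; rewrite /wick big_ord_recl /= hermiteS0.
under eq_bigr => j _ do rewrite /bump /= add1n hermiteSS mulnDl mulnDr.
rewrite big_split /= addnCA; congr (_ + _)%N.
case: K aK => // K aK.
rewrite [RHS]big_ord_recl /= [in LHS]big_ord_recr /=.
rewrite (hermite_small (j := K.+2)); last by lia.
rewrite muln0 mul0n muln0 addn0; congr (_ + _)%N.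
apply: eq_bigr => j _; rewrite /bump /= add1n (factS j.+1); lia.
Qed.

Lemma wickC K a b : wick K a b = wick K b a.
Proof. by apply: eq_bigr => j _; rewrite (mulnC (hermite a j)). Qed.

(** Multiplication by x is symmetric for the scalar product, as shown by
[wickS], so that all powers can be moved to one side. *)
Lemma wick_gauss_mom K a b : (a + b < K)%N -> wick K a b = gauss_mom (a + b).
Proof.
elim: a b => [|a IH] b abK.
  case: K abK => // K _; rewrite /wick big_ord_recl big1 ?addn0 => [|j _].
    by rewrite !hermite0 !mul1n.
  by rewrite (hermite_small (a := 0)) // mul0n muln0.
rewrite addSnnS -IH; last by rewrite -addSnnS.
case: K abK IH => // K abK _; rewrite wickS; last by lia.
rewrite [RHS]wickC wickS; last by lia.
by rewrite addnC; congr (_ + _)%N; apply: eq_bigr => j _; congr (_ * _)%N; rewrite mulnC.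
Qed.

Definition monos n d : seq 'X_{1..n} := [seq s2m (val t) | t <- enum (mpoly.basis n d)].

Section Catalecticant.
Variables (F : numClosedFieldType) (n s : nat).

Let N := size (monos n s).
Let expo (i : 'I_N) : 'X_{1..n} := nth 0%MM (monos n s) i.

Definition catmx (f : {mpoly F[n]}) : 'M[F]_(size (monos n s)) :=
  \matrix_(i, j) apolar (nth 0%MM (monos n s) i + nth 0%MM (monos n s) j)%MM f.

Lemma mdeg_expo i : mdeg (expo i) = s.
Proof. by apply/eqP; rewrite basis_cover mem_nth. Qed.

Lemma expo_inj : injective expo.
Proof.
move=> i j /eqP; rewrite nth_uniq ?uniq_basis // => /eqP; exact: val_inj.
Qed.

Lemma expo_lep i j : (forall k, (expo i k <= expo j k)%N) -> i = j.
Proof.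
move=> /mnm_lepP le; apply: expo_inj; rewrite -(submK le).
have /eqP : mdeg (expo j - expo i) = 0%N.
  by apply: (@addIn s); rewrite add0n -{1}(mdeg_expo i) -mdegD submK // mdeg_expo.
by rewrite mdeg_eq0 => /eqP ->; rewrite add0m.
Qed.

(** Hermite expansion in every variable writes a vector of the kernel as a family
of Hermite coefficients whose weighted sum of squares is zero.  Among them are
the coefficients of the vector itself, because in degree s the expansion is
triangular with unit diagonal. *)
Lemma catmx_sumsq : \det (catmx (sumsq F n ^+ s)) != 0.
Proof.
rewrite -unitfE -unitmxE -row_free_unit; apply/inj_row_free => v vM.
pose M i j : F := \prod_k (gauss_mom (expo i k + expo j k))%:R.
have v0 j : \sum_i v 0 i * M i j = 0.
  have K0 : (2 ^ s * s`!)%:R != 0 :> F by rewrite pnatr_eq0 -lt0n muln_gt0 expn_gt0 fact_gt0.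
  apply: (mulfI K0); rewrite mulr0.
  move/rowP/(_ j): vM; rewrite !mxE => vM; rewrite -[RHS]vM mulr_sumr.
  apply: eq_bigr => i _; rewrite mxE apolar_sumsq.
    rewrite mulrCA; congr (_ * (_ * _)); apply: eq_bigr => k _.
    by rewrite mnmDE.
  by rewrite mdegD !mdeg_expo; lia.
pose K := (2 * s).+1.
pose H i (J : {ffun 'I_n -> 'I_K}) : F := \prod_k (hermite (expo i k) (J k))%:R.
pose W (J : {ffun 'I_n -> 'I_K}) : F := \prod_k ((J k)`!)%:R.
have le_expo i k : (expo i k <= s)%N.
  by rewrite -(mdeg_expo i) mdegE (bigD1 k) //= leq_addr.
have ME i j : M i j = \sum_J W J * (H i J * H j J).
  transitivity (\prod_k \sum_(t < K) ((t`!)%:R * ((hermite (expo i k) t)%:R * (hermite (expo j k) t)%:R)) : F).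
    apply: eq_bigr => k _; rewrite -(@wick_gauss_mom K).
      by rewrite /wick natr_sum; apply: eq_bigr => t _; rewrite !natrM.
    by rewrite /K; have := le_expo i k; have := le_expo j k; lia.
  rewrite bigA_distr_bigA; apply: eq_bigr => J _.
  by rewrite /W /H -!big_split.
pose S J := \sum_i v 0 i * H i J.
have HR i J : (H i J)^* = H i J.
  by rewrite rmorph_prod; apply: eq_bigr => k _; rewrite rmorph_nat.
have sum0 : \sum_J W J * `|S J| ^+ 2 = 0.
  transitivity (\sum_j (v 0 j)^* * \sum_i v 0 i * M i j); last first.
    by rewrite big1 // => j _; rewrite v0 mulr0.
  rewrite (eq_bigr (fun J => \sum_j \sum_i (v 0 j)^* * (v 0 i * (W J * (H i J * H j J))))).
    rewrite exchange_big; apply: eq_bigr => j _.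
    rewrite exchange_big mulr_sumr; apply: eq_bigr => i _ /=.
    by rewrite ME !mulr_sumr.
  move=> J _; rewrite normCK mulrCA exchange_big {1}/S mulr_suml /=.
  apply: eq_bigr => i _; rewrite rmorph_sum !mulr_sumr; apply: eq_bigr => j _ /=.
  by rewrite rmorphM /= HR; ring.
have W0 J : 0 < W J by apply: prodr_gt0 => k _; rewrite ltr0n fact_gt0.
have S0 J : S J = 0.
  have /eqP : W J * `|S J| ^+ 2 = 0.
    by apply: (psumr_eq0P _ sum0) => // J' _; rewrite mulr_ge0 ?exprn_ge0 // ltW.
  by rewrite mulf_eq0 (gt_eqF (W0 J)) expf_eq0 normr_eq0 /= => /eqP.
apply/rowP => i; rewrite [RHS]mxE.
pose J := [ffun k => inord (expo i k) : 'I_K].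
have JE k : J k = expo i k :> nat by rewrite ffunE inordK // /K; have := le_expo i k; lia.
rewrite -(S0 J) /S (bigD1 i) //= [X in _ = _ + X]big1 ?addr0.
  rewrite /H big1 ?mulr1 // => k _; by rewrite JE hermite_diag.
move=> j ji; suff [k kj] : exists k, (expo j k < expo i k)%N.
  by rewrite /H (bigD1 k) //= JE hermite_small // mul0r mulr0.
apply/existsP; apply: contraNT ji; rewrite negb_exists => /forallP h.
by rewrite eq_sym; apply/eqP/expo_lep => k; rewrite leqNgt h.
Qed.

(** Each summand contributes a matrix of rank one, the tensor square of its
vector of values on monomials. *)
Lemma catmx_waring r (l : 'I_r -> {mpoly F[n]}) :
    (forall i, l i \is 1.-homog) -> (r < size (monos n s))%N ->
  \det (catmx (\sum_(i < r) l i ^+ (2 * s))) = 0.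
Proof.
move=> lh rN; apply/eqP; rewrite -[_ == 0]negbK -unitfE -unitmxE -row_free_unit.
apply/negP => /eqP rk.
pose A : 'M[F]_(r, size (monos n s)) :=
  \matrix_(k, i) \prod_t ((l k)@_U_(t)) ^+ (expo i t).
have : catmx (\sum_(i < r) l i ^+ (2 * s)) = (2 * s)`!%:R *: (A^T *m A).
  apply/matrixP => i j; rewrite !mxE apolar_sum mulr_sumr; apply: eq_bigr => k _.
  rewrite !mxE {1}(homog1_linform (lh k)) apolar_linform.
    congr (_ * _); rewrite -big_split /=; apply: eq_bigr => t _.
    by rewrite mnmDE exprD.
  by rewrite mdegD !mdeg_expo; lia.
move=> e; have : (\rank (catmx (\sum_(i < r) l i ^+ (2 * s))) <= r)%N.
  rewrite e (leq_trans (mxrank_scale _ _)) //.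
  by rewrite (leq_trans (mxrankM_maxr _ _)) // rank_leq_row.
by rewrite rk leqNgt rN.
Qed.
End Catalecticant.

(** * Limits of forms and the lower bound *)

Section Limits.
Variable K : numFieldType.

Lemma cvg_sum_seq (I : Type) (r : seq I) (P : pred I) (u : I -> nat -> K) (a : I -> K) :
  (forall i, P i -> u i k @[k --> \oo] --> a i) ->
  (\sum_(i <- r | P i) u i k) @[k --> \oo] --> \sum_(i <- r | P i) a i.
Proof. by move=> h; apply: cvg_big => //; exact: add_continuous. Qed.

Lemma cvg_prod_seq (I : Type) (r : seq I) (P : pred I) (u : I -> nat -> K) (a : I -> K) :
  (forall i, P i -> u i k @[k --> \oo] --> a i) ->
  (\prod_(i <- r | P i) u i k) @[k --> \oo] --> \prod_(i <- r | P i) a i.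
Proof. by move=> h; apply: cvg_big => //; exact: mul_continuous. Qed.

Lemma cvg_det n (M : nat -> 'M[K]_n) (L : 'M[K]_n) :
  (forall i j, M k i j @[k --> \oo] --> L i j) ->
  \det (M k) @[k --> \oo] --> \det L.
Proof.
move=> ML; apply: cvg_sum_seq => p _; apply: cvgMl_tmp.
by apply: cvg_prod_seq => i _; exact: ML.
Qed.
End Limits.

(** Positive elements of [Cplx R] are real, so that the Archimedean property of
[R] applies. *)
Lemma cvg_invSn (R : realType) : (k.+1%:R^-1 : Cplx R) @[k --> \oo] --> (0 : Cplx R).
Proof.
apply/cvgr0Pnorm_lt => e e0.
have [a ae] : exists a : R, e^-1 = a%:C%C.
  by exists (complex.Re e^-1); rewrite RRe_real // realE ltW // invr_gt0.
have a0 : 0 <= a by rewrite -lecR -ae ltW // invr_gt0.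
exists (Num.bound a) => //= k /= ak.
rewrite normfV ger0_norm // invf_plt ?posrE ?ltr0n //.
rewrite ae; apply: (lt_le_trans (y := (Num.bound a)%:R)).
  by rewrite -(rmorph_nat (real_complex R)) ltcR archi_boundP.
by rewrite ler_nat leqW.
Qed.

Section Border.
Variable R : realType.
Local Notation C := (Cplx R).

Lemma waring_homog n d (f : {mpoly C[n]}) r : waring_decomp d f r -> f \is d.-homog.
Proof.
move=> [l lh ->]; apply: rpred_sum => i _.
by have := dhomogMn d (lh i); rewrite mul1n.
Qed.

Lemma homog_msize n d (f : {mpoly C[n]}) : f \is d.-homog -> (msize f <= d.+1)%N.
Proof.
move=> /dhomogP fh; rewrite msizeE big_seq.
by elim/big_ind: _ => // [x y hx hy|m /fh /= ->]; rewrite ?geq_max ?hx.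
Qed.

Lemma border_homog n d (f : {mpoly C[n]}) r : border_rk_le d f r -> f \is d.-homog.
Proof.
move=> [u uw ucvg]; apply/dhomogP => m; rewrite mcoeff_msupp.
apply: contraNeq => md; apply/eqP.
apply: (cvg_unique (@norm_hausdorff _ C) (ucvg m)).
rewrite (_ : (fun k => _) = fun=> 0); first exact: cvg_cst.
by apply/funext => k; have [j _ /waring_homog uh] := uw k; exact: dhomog_nemf_coeff uh md.
Qed.

Lemma waring_comp n p d (f : {mpoly C[n]}) r (t : n.-tuple {mpoly C[p]}) :
    (forall i, tnth t i \is 1.-homog) ->
  waring_decomp d f r -> waring_decomp d (f \mPo t) r.
Proof.
move=> th [l lh ->]; exists (fun i => l i \mPo t); last first.
  by rewrite raddf_sum; apply: eq_bigr => i _ /=; rewrite rmorphXn.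
move=> i; rewrite (homog1_linform (lh i)) raddf_sum; apply: rpred_sum => j _ /=.
rewrite comp_mpolyZ comp_mpolyXU -tnth_nth; apply: rpredZ; exact: th.
Qed.

Lemma rk_le_comp n p d (f : {mpoly C[n]}) r (t : n.-tuple {mpoly C[p]}) :
    (forall i, tnth t i \is 1.-homog) ->
  rk_le d f r -> rk_le d (f \mPo t) r.
Proof. by move=> th [k kr /(waring_comp th) fk]; exists k. Qed.

Lemma border_comp n p d (f : {mpoly C[n]}) r (t : n.-tuple {mpoly C[p]}) :
    (forall i, tnth t i \is 1.-homog) ->
  border_rk_le d f r -> border_rk_le d (f \mPo t) r.
Proof.
move=> th fr; have fh := border_homog fr; case: fr => u ur ucvg.
exists (fun k => u k \mPo t) => [k|m]; first exact: rk_le_comp.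
rewrite (comp_mpolywE _ (homog_msize fh)) raddf_sum /=.
rewrite (_ : (fun k => _) = fun k => \sum_(m' : 'X_{1..n < d.+1})
    (u k)@_m' * (\prod_(i < n) tnth t i ^+ m' i)@_m).
  by apply: cvg_sum_seq => m' _; rewrite mcoeffZ; exact: cvgMr_tmp.
apply/funext => k; have [j _ /waring_homog uh] := ur k.
rewrite (comp_mpolywE _ (homog_msize uh)) raddf_sum /=.
by apply: eq_bigr => m' _; rewrite mcoeffZ.
Qed.

Lemma rk_le_border n d (f : {mpoly C[n]}) r : rk_le d f r -> border_rk_le d f r.
Proof. by move=> fr; exists (fun=> f) => // m; exact: cvg_cst. Qed.

Lemma border_sumsq n s r :
  border_rk_le (2 * s) (sumsq C n ^+ s) r -> (size (monos n s) <= r)%N.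
Proof.
move=> [u ur ucvg]; rewrite leqNgt; apply/negP => rN.
have := catmx_sumsq C n s; apply/negP; rewrite negbK; apply/eqP.
have h : \det (catmx s (u k)) @[k --> \oo] --> \det (catmx s (sumsq C n ^+ s)).
  apply: cvg_det => i j; rewrite mxE.
  under eq_cvg do rewrite mxE.
  by rewrite /apolar; apply: cvgMl_tmp.
apply: (cvg_unique (@norm_hausdorff _ C) h).
rewrite (_ : (fun k => _) = fun=> 0); first exact: cvg_cst.
apply/funext => k; have [j jr [l lh ->]] := ur k.
by rewrite catmx_waring //; exact: leq_ltn_trans rN.
Qed.

End Border.

(** * Interpolation at points on parallel lines *)

(** A family [lam a b] of scalars stands for the linear functional with these
values on the monomials x^a y^b. *)
Section Interp.
Variable F : fieldType.

(** Newton's method: by induction, the remaining points take care of the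
functional [p |-> f ((y - y0) p)], and dividing their weights by [y - y0] leaves a
functional which kills the multiples of [y - y0], hence is an evaluation. *)
Lemma line_interp (rs : seq F) (f : nat -> F) : uniq rs ->
  exists w : F -> F, forall b, (b < size rs)%N ->
    f b = \sum_(y <- rs) w y * y ^+ b.
Proof.
elim: rs f => [|y0 rs IH] f /=; first by exists (fun=> 0).
case/andP=> y0rs /IH{IH} IH.
have [w' Hw'] := IH (fun b => f b.+1 - y0 * f b).
pose r b := f b - \sum_(y <- rs) w' y / (y - y0) * y ^+ b.
have rE b : (b <= size rs)%N -> r b = r 0%N * y0 ^+ b.
  elim: b => [|b IHb] bs; first by rewrite expr0 mulr1.
  rewrite exprS mulrCA -IHb 1?ltnW //.
  have fE : f b.+1 = y0 * f b + \sum_(y <- rs) w' y * y ^+ b by rewrite -Hw' //; ring.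
  suff sE : \sum_(y <- rs) w' y / (y - y0) * y ^+ b.+1 =
    y0 * (\sum_(y <- rs) w' y / (y - y0) * y ^+ b) + \sum_(y <- rs) w' y * y ^+ b.
    by rewrite /r fE sE; ring.
  rewrite mulr_sumr -big_split /= big_seq [RHS]big_seq; apply: eq_bigr => y yrs.
  have : y - y0 != 0 by rewrite subr_eq0; apply: contraNneq y0rs => <-.
  by move=> ?; rewrite exprS; field.
exists (fun y => if y == y0 then r 0%N else w' y / (y - y0)) => b bs.
rewrite big_cons eqxx -rE // /r big_seq [X in _ + X]big_seq.
under [X in _ + X]eq_bigr => y yrs.
  rewrite ifN; last by apply: contraNneq y0rs => <-.
  over.
by rewrite subrK.
Qed.

(** The same reduction with [x - X n] in place of [y - y0]: what is left after
interpolation on the first lines kills the multiples of [x - X n], so it is a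
functional of y alone, to be interpolated on the last line. *)
Lemma lines_interp (X : nat -> F) (rs : nat -> seq F) (n : nat)
    (lam : nat -> nat -> F) :
    (forall i j, (i < j < n)%N -> X i != X j) ->
    (forall j, (j < n)%N -> uniq (rs j) /\ size (rs j) = j.+1) ->
  exists S : seq (F * F * F),
    [/\ size S = 'C(n.+1, 2),
        forall P, P \in S -> exists j, [/\ (j < n)%N, P.1.2 = X j & P.2 \in rs j]
      & forall a b, (a + b < n)%N ->
          lam a b = \sum_(P <- S) P.1.1 * (P.1.2 ^+ a * P.2 ^+ b)].
Proof.
elim: n lam => [|n IH] lam Xn rsn; first by exists [::].
have [||S [Ssz Sin Slam]] := IH (fun a b => lam a.+1 b - X n * lam a b).
- by move=> i j ijn; apply: Xn; lia.
- by move=> j jn; apply: rsn; lia.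
pose Q (P : F * F * F) := P.1.1 / (P.1.2 - X n).
pose r a b := lam a b - \sum_(P <- S) Q P * (P.1.2 ^+ a * P.2 ^+ b).
have rE a b : (a + b <= n)%N -> r a b = X n ^+ a * r 0%N b.
  elim: a => [|a IHa] abn; first by rewrite mul1r.
  have {}Slam := Slam a b abn.
  rewrite exprS -mulrA -IHa; last by rewrite ltnW.
  have lamE : lam a.+1 b = X n * lam a b + \sum_(P <- S) P.1.1 * (P.1.2 ^+ a * P.2 ^+ b).
    by rewrite -Slam; ring.
  suff sE : \sum_(P <- S) Q P * (P.1.2 ^+ a.+1 * P.2 ^+ b) =
    X n * (\sum_(P <- S) Q P * (P.1.2 ^+ a * P.2 ^+ b)) +
    \sum_(P <- S) P.1.1 * (P.1.2 ^+ a * P.2 ^+ b).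
    by rewrite /r lamE sE; ring.
  rewrite mulr_sumr -big_split /= big_seq [RHS]big_seq; apply: eq_bigr => P PS.
  have [j [jn Pj _]] := Sin P PS.
  have : P.1.2 - X n != 0 by rewrite subr_eq0 Pj Xn // jn ltnSn.
  by move=> ?; rewrite exprS /Q; field.
have [rs_uniq rs_size] := rsn n (ltnSn n).
have [w Hw] := line_interp (r 0%N) rs_uniq.
exists ([seq (Q P, P.1.2, P.2) | P <- S] ++ [seq (w y, X n, y) | y <- rs n]).
split.
- by rewrite size_cat !size_map Ssz rs_size [RHS]binS bin1.
- move=> P; rewrite mem_cat => /orP[] /mapP[].
    move=> P' /Sin [j [jn ? ?]] -> /=; exists j; split=> //; lia.
  by move=> y yrs ->; exists n; rewrite /=.
move=> a b abn; rewrite big_cat !big_map /=.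
have {}rE := rE a b abn.
rewrite Hw in rE; last by rewrite rs_size; lia.
apply/eqP; rewrite addrC -subr_eq; apply/eqP; rewrite -/(r a b) rE mulr_sumr.
by apply: eq_bigr => y _; ring.
Qed.

End Interp.

(** * Zeros of orthogonal polynomials *)

(** Polynomials given by a three-term recurrence with positive coefficients are
orthogonal for a positive measure on the real line. *)
Section Favard.
Variable F : numClosedFieldType.
Variables (w : nat -> F) (P : nat -> {poly F}).
Hypotheses (P0 : P 0%N = 1) (P1 : P 1%N = 'X).
Hypothesis (PS : forall n, P n.+2 = 'X * P n.+1 - w n *: P n).

Lemma favard_size n : size (P n) = n.+1 /\ P n \is monic.
Proof.
elim/ltn_ind: n => -[|[|n]] IH.
- by rewrite P0 size_poly1 monic1.
- by rewrite P1 size_polyX monicX.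
have [s1 m1] := IH n.+1 (ltnSn _); have [s0 _] := IH n (leqW (leqnn _)).
have sX : size ('X * P n.+1) = n.+3.
  by rewrite mulrC size_mulX ?s1 // monic_neq0.
have lt : (size (- (w n *: P n))%R < size ('X * P n.+1)%R)%N.
  by rewrite sX size_polyN (leq_ltn_trans (size_scale_leq _ _)) // s0 ltnS leqnSn.
rewrite PS; split; first by rewrite size_polyDl.
by rewrite monicE lead_coefDl // lead_coefM lead_coefX mul1r -monicE.
Qed.

Variable j : nat.
Hypothesis (w_gt0 : forall n, (n < j)%N -> 0 < w n).

Let wR n : (n < j)%N -> (w n)^* = w n.
Proof. by move=> /w_gt0 /gtr0_real /CrealP. Qed.

(** Christoffel and Darboux: at z and its conjugate, the antisymmetric expression
in two consecutive polynomials is [z - z^*] times a sum of squared moduli with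
positive weights, and at a zero it vanishes. *)
Lemma favard_root_real z : root (P j.+1) z -> z^* = z.
Proof.
move=> Pz.
have [S [S0 SE]] : exists S, 0 < S /\
    (P j.+1).[z] * (P j).[z]^* - (P j.+1).[z]^* * (P j).[z] = (z - z^*) * S.
  elim: {-2}j (leqnn j) {Pz} => [|n IH] nj.
    by exists 1; rewrite ltr01 P0 P1 hornerX hornerC rmorph1 !mulr1.
  have [S [S0 SE]] := IH (ltnW nj).
  exists (`|(P n.+1).[z]| ^+ 2 + w n * S); split.
    by rewrite ltr_wpDl ?exprn_ge0 // mulr_gt0 ?w_gt0.
  rewrite mulrDr (mulrCA _ (w n)) -SE normCK PS !hornerE.
  by rewrite rmorphB !rmorphM /= wR //; ring.
move: SE; rewrite (rootP Pz) rmorph0 !mul0r subr0 => /esym /eqP.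
by rewrite mulf_eq0 (gt_eqF S0) orbF subr_eq0 => /eqP.
Qed.

(** The confluent form of the same identity makes the Wronskian of two consecutive
polynomials positive at real points, which excludes double zeros. *)
Lemma favard_roots : exists rs : seq F,
  [/\ uniq rs, size rs = j.+1 & forall y, y \in rs -> (P j.+1).[y] = 0].
Proof.
have [sP mP] := favard_size j.+1.
have [rs rsE] := closed_field_poly_normal (P j.+1).
rewrite (monicP mP) scale1r in rsE.
exists rs; split.
- rewrite -separable_prod_XsubC -rsE unlock.
  apply/Pdiv.ClosedField.coprimepP => z Pz.
  apply/negP => dPz.
  have zR := favard_root_real Pz.
  have PR n : (n <= j)%N -> (P n).[z]^* = (P n).[z].
    elim/ltn_ind: n => -[|[|n]] IH nj; first by rewrite P0 hornerC rmorph1.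
      by rewrite P1 hornerX.
    by rewrite PS !hornerE rmorphB !rmorphM /= zR wR ?IH //; lia.
  have : 0 < (P j.+1)^`().[z] * (P j).[z] - (P j.+1).[z] * (P j)^`().[z].
    elim: {-2}j (leqnn j) {Pz dPz} => [|n IH] nj.
      by rewrite P0 P1 derivX derivC !hornerE subr0 ltr01.
    have := IH (ltnW nj); set S := (X in 0 < X) => S0.
    have -> : (P n.+2)^`().[z] * (P n.+1).[z] - (P n.+2).[z] * (P n.+1)^`().[z] =
       `|(P n.+1).[z]| ^+ 2 + w n * S.
      rewrite normCK PR // /S PS derivB derivM derivX derivZ !hornerE.
      by ring.
    by rewrite ltr_wpDl ?exprn_ge0 // mulr_gt0 ?w_gt0.
  by rewrite (rootP Pz) (rootP dPz) !mul0r subr0 ltxx.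
- by move: sP; rewrite rsE size_prod_XsubC => -[].
by move=> y yrs; apply/rootP; rewrite rsE root_prod_XsubC.
Qed.
End Favard.

(** * The cubature rule *)

Section Cubature.
Variable F : numClosedFieldType.
Variable s : nat.

(** The coefficients of the recurrence between the harmonic forms of degree s + 1
and weights s + 1 - n, normalised to have leading term x^(s+1-n) y^n. *)
Definition rec_coef (n : nat) : F :=
  (n.+1%:R * (2 * s + 2 - n)%:R) / (2 * (s - n)%:R * (s.+1 - n)%:R).

(** The functional [p |-> lam (P_n p)], where P_n = y P_(n-1) - c_(n-2) (x - (n - 2))
P_(n-2) is the n-th shifted Legendre polynomial in x and y. *)
Fixpoint legendre_op (n : nat) (lam : nat -> nat -> F) : nat -> nat -> F :=
  match n with
  | 0 => lam
  | n1.+1 => match n1 with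
     | 0 => fun a b => lam a b.+1
     | n0.+1 => fun a b => legendre_op n1 lam a b.+1
           - rec_coef n0 * (legendre_op n0 lam a.+1 b - n0%:R * legendre_op n0 lam a b)
     end
  end.

Lemma legendre_opSS n lam a b : legendre_op n.+2 lam a b = legendre_op n.+1 lam a b.+1
  - rec_coef n * (legendre_op n lam a.+1 b - n%:R * legendre_op n lam a b).
Proof. by []. Qed.

(** The leading term of P_n is y^n; all other terms have lower degree, and they
have no larger grade when x and y are given the grades 2 and 1. *)
Lemma legendre_op_lead n lam D H :
    (forall a b, (a + b < D)%N -> (2 * a + b < H)%N -> lam a b = 0) ->
  forall a b, (a + b + n <= D)%N -> (2 * a + b + n < H)%N ->
    legendre_op n lam a b = lam a (b + n)%N.
Proof.
move=> lam0; elim/ltn_ind: n => -[|[|n]] IH a b hD hH.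
- by rewrite addn0.
- by rewrite addn1.
rewrite legendre_opSS !IH; try lia.
by rewrite (lam0 a.+1) ?(lam0 a (b + n)%N); try lia; rewrite !(mulr0, subr0) !addnS.
Qed.

Lemma legendre_opB n lam mu a b :
  legendre_op n (fun a b => lam a b - mu a b) a b = legendre_op n lam a b - legendre_op n mu a b.
Proof.
elim/ltn_ind: n a b => -[|[|n]] IH a b //.
by rewrite !legendre_opSS !IH //; try lia; ring.
Qed.

Arguments legendre_op : simpl never.

(** The functional [p |-> lam (q p)], where q is the product of the x - j for j in
l. *)
Fixpoint lines_op (l : seq nat) (lam : nat -> nat -> F) : nat -> nat -> F :=
  if l is j :: l' then lines_op l' (fun a b => lam a.+1 b - j%:R * lam a b) else lam.

(** The terms of q other than x^(size l) have both lower degree and lower grade;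
hence the weak inequality between grades, unlike in [legendre_op_lead]. *)
Lemma lines_op_lead l lam D H :
    (forall a b, (a + b < D)%N -> (2 * a + b < H)%N -> lam a b = 0) ->
  forall a b, (a + b + size l <= D)%N -> (2 * a + b + 2 * size l <= H)%N ->
    lines_op l lam a b = lam (a + size l)%N b.
Proof.
elim: l lam D H => [|j l IH] lam D H lam0 a b hD hH /=; first by rewrite addn0.
move: hD hH => /= hD hH.
rewrite (IH _ D.-1 H.-2); try lia.
  by rewrite (lam0 (a + size l)%N); try lia; rewrite mulr0 subr0 addnS.
move=> a' b' h1 h2; rewrite !lam0; try lia.
by rewrite mulr0 subr0.
Qed.

Lemma eq_lines_op l lam mu : (forall a b, lam a b = mu a b) ->
  forall a b, lines_op l lam a b = lines_op l mu a b.
Proof.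
by elim: l lam mu => [|j l IH] lam mu e a b //=; apply: IH => *; rewrite !e.
Qed.

Lemma lines_opB l lam mu a b :
  lines_op l (fun a b => lam a b - mu a b) a b = lines_op l lam a b - lines_op l mu a b.
Proof.
elim: l lam mu => [|j l IH] lam mu //=.
by rewrite -IH; apply: eq_lines_op => *; ring.
Qed.

(** The polynomial P_n as a polynomial in y, x being specialised. *)
Fixpoint legendre_poly (x : F) (n : nat) : {poly F} :=
  match n with
  | 0 => 1
  | n1.+1 => match n1 with
     | 0 => 'X
     | n0.+1 => 'X * legendre_poly x n1 - (rec_coef n0 * (x - n0%:R)) *: legendre_poly x n0
     end
  end.

Arguments legendre_poly : simpl never.

Lemma legendre_polySS x n :
  legendre_poly x n.+2 = 'X * legendre_poly x n.+1 - (rec_coef n * (x - n%:R)) *: legendre_poly x n.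
Proof. by []. Qed.

(** For x = j the term of index j of the recurrence drops out, so that P_(j+1)
divides P_(j+2), and therefore all P_n with n > j. *)
Lemma legendre_poly_root j n y : (j < n)%N ->
  (legendre_poly j%:R j.+1).[y] = 0 -> (legendre_poly j%:R n).[y] = 0.
Proof.
move=> jn r0.
have r1 : (legendre_poly j%:R j.+2).[y] = 0.
  by rewrite legendre_polySS !hornerE r0; ring.
rewrite -(subnKC jn).
suff [] : (legendre_poly j%:R (j.+1 + (n - j.+1))).[y] = 0 /\
          (legendre_poly j%:R (j.+1 + (n - j.+1)).+1).[y] = 0 by [].
elim: (n - j.+1)%N => [|m [IH1 IH2]]; first by rewrite addn0.
rewrite addnS; move: (j.+1 + m)%N IH1 IH2 => k IH1 IH2; split => //.
by rewrite legendre_polySS !(hornerD, hornerN, hornerM, hornerZ) IH2 IH1; ring.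
Qed.

Definition nodal (S : seq (F * F * F)) (a b : nat) :=
  \sum_(P <- S) P.1.1 * (P.1.2 ^+ a * P.2 ^+ b).

Lemma legendre_op_nodal S n a b : legendre_op n (nodal S) a b =
  \sum_(P <- S) (P.1.1 * (legendre_poly P.1.2 n).[P.2]) * (P.1.2 ^+ a * P.2 ^+ b).
Proof.
elim/ltn_ind: n a b => -[|[|n]] IH a b.
- by apply: eq_bigr => P _; rewrite hornerC mulr1.
- by apply: eq_bigr => P _; rewrite /legendre_poly hornerX exprS -mulrA; congr (_ * _); rewrite mulrCA.
rewrite legendre_opSS !IH; try lia.
rewrite mulr_sumr -sumrB mulr_sumr -sumrB; apply: eq_bigr => P _.
by rewrite legendre_polySS !(hornerD, hornerN, hornerM, hornerZ, hornerX) !exprS; ring.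
Qed.

Lemma lines_op_sum l (S : seq (F * F * F)) (c : F * F * F -> F) a b :
  lines_op l (fun a b => \sum_(P <- S) c P * (P.1.2 ^+ a * P.2 ^+ b)) a b =
  \sum_(P <- S) (c P * \prod_(j <- l) (P.1.2 - j%:R)) * (P.1.2 ^+ a * P.2 ^+ b).
Proof.
elim: l c => [|j l IH] c /=.
  by apply: eq_bigr => P _; rewrite big_nil mulr1.
rewrite (@eq_lines_op _ _ (fun a b =>
    \sum_(P <- S) (c P * (P.1.2 - j%:R)) * (P.1.2 ^+ a * P.2 ^+ b))).
  by rewrite IH; apply: eq_bigr => P _; rewrite big_cons -!mulrA.
move=> a' b'; rewrite mulr_sumr -sumrB; apply: eq_bigr => P _.
by rewrite exprS; ring.
Qed.

Definition on_lines (S : seq (F * F * F)) := forall P, P \in S ->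
  exists j, [/\ (j < s.+1)%N, P.1.2 = j%:R & (legendre_poly j%:R j.+1).[P.2] = 0].

(** Multiplication by the curve of degree s + 1 whose leading form is
x^(s+1-n) y^n. *)
Definition curve_op n lam := lines_op (iota n (s.+1 - n)) (legendre_op n lam).

Lemma curve_op_nodal S n a b : on_lines S -> curve_op n (nodal S) a b = 0.
Proof.
move=> Sl; rewrite /curve_op (eq_lines_op _ (fun a b => legendre_op_nodal S n a b)) lines_op_sum.
rewrite big_seq big1 // => P /Sl [j [js -> r0]].
have [nj|jn] := leqP n j; last by rewrite (legendre_poly_root jn r0) !(mulr0, mul0r).
rewrite (big_rem j) /=; last by rewrite mem_iota; lia.
by rewrite subrr !(mulr0, mul0r).
Qed.

(** The functional attached to the power s of [conic], up to a scalar. *)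
Definition Lam a b : F := if (2 * a + b == 2 * s)%N then (a`! * gauss_mom b)%:R else 0.

Lemma Lam_low a b : (2 * a + b < 2 * s)%N -> Lam a b = 0.
Proof. by rewrite /Lam; case: eqP => // ->; rewrite ltnn. Qed.

Lemma legendre_op_Lam_low n a b : (2 * a + b + n < 2 * s)%N -> legendre_op n Lam a b = 0.
Proof.
move=> abn; rewrite (@legendre_op_lead _ _ (a + b + n) (2 * s)) //.
  by rewrite Lam_low // addnA.
by move=> *; exact: Lam_low.
Qed.

(** The moments of P_n in the grade on which [Lam] lives, a Saalschutz sum; the
products of linear factors make them vanish for the exponents of x at hand in
[curve_op_Lam].  The recurrence in n leads from each parity to the
other. *)
Lemma legendre_op_Lam p : (2 * p <= s.+1)%N -> exists K : F,
  (forall a b, (2 * a + b + 2 * p = 2 * s)%N ->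
    legendre_op (2 * p) Lam a b =
    K * (a`! * gauss_mom (2 * (s - a - p)))%:R * \prod_(i < p) (s%:R - p%:R - i%:R - a%:R))
 /\ (forall a b, (2 * p <= s)%N -> (2 * a + b + (2 * p).+1 = 2 * s)%N ->
    legendre_op (2 * p).+1 Lam a b =
    K * ((s%:R + 1 - p%:R) / (s%:R + 1 - 2 * p%:R)) * (a`! * gauss_mom (2 * (s - a - p)))%:R
      * \prod_(i < p) (s%:R - p%:R - i.+1%:R - a%:R)).
Proof.
elim: p => [|p IH] ps.
  exists 1; split => a b.
    move=> ab; rewrite big_ord0 !mulr1 mul1r /legendre_op /= /Lam ifT; last by apply/eqP; lia.
    by congr (_ * gauss_mom _)%:R; lia.
  move=> _ ab; have h : s%:R + 1 != 0 :> F by rewrite natr1 pnatr_eq0.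
  rewrite big_ord0 /legendre_op /= !mulr0 !subr0 divff // !mulr1 mul1r /Lam ifT; last by apply/eqP; lia.
  by congr (_ * gauss_mom _)%:R; lia.
have [|K [IHe IHo]] := IH; first by lia.
have d0 : s%:R - 2 * p%:R != 0 :> F.
  by rewrite -natrM -natrB ?pnatr_eq0; lia.
have d1 : s%:R + 1 - 2 * p%:R != 0 :> F.
  by rewrite natr1 -natrM -natrB ?pnatr_eq0; lia.
pose K' := K * (s%:R + 1 - p%:R) * (2 * s%:R - 2 * p%:R + 1) /
           ((s%:R - 2 * p%:R) * (s%:R + 1 - 2 * p%:R)).
have IHe' a b : (2 * a + b + 2 * p.+1 = 2 * s)%N ->
    legendre_op (2 * p.+1) Lam a b =
    K' * (a`! * gauss_mom (2 * (s - a - p.+1)))%:R * \prod_(i < p.+1) (s%:R - p.+1%:R - i%:R - a%:R).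
  move=> ab; rewrite mulnS add2n legendre_opSS (legendre_op_Lam_low (a := a) (b := b)); last by lia.
  rewrite IHo ?IHe; try lia.
  have [m mE] : exists m, (s = a + p.+1 + m)%N by exists (s - a - p.+1)%N; lia.
  have -> : (s - a - p = m.+1)%N by lia.
  have -> : (s - a.+1 - p = m)%N by lia.
  have -> : (s - a - p.+1 = m)%N by lia.
  have mR : m%:R = s%:R - a%:R - p%:R - 1 :> F by rewrite mE !natrD -natr1; ring.
  have -> : gauss_mom (2 * m.+1) = ((2 * m).+1 * gauss_mom (2 * m))%N by rewrite mulnS add2n.
  rewrite factS !natrM -!natr1 natrM mR mulr0 subr0.
  rewrite big_ord_recr /=.
  set Q1 := \prod_(i < p) _; set Q2 := \prod_(i < p) _; set Q3 := \prod_(i < p) _.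
  have -> : Q1 = Q3 by apply: eq_bigr => i _; rewrite -?natr1; ring.
  have -> : Q2 = Q3 by apply: eq_bigr => i _; rewrite -?natr1; ring.
  rewrite /rec_coef !natrB ?natrM -?natr1; try lia.
  rewrite natrM in d0 d1 *.
  by rewrite /K'; field; rewrite d0 d1.
exists K'; split => // a b sp ab.
have d2 : s%:R - 1 - 2 * p%:R != 0 :> F.
  rewrite (_ : _ - _ - _ = s%:R - (2 * p).+1%:R); last by ring.
  by rewrite -natrB ?pnatr_eq0; lia.
have eq2 : (2 * p.+1 = (2 * p).+2)%N by lia.
rewrite eq2 legendre_opSS -{1}eq2 IHe'; last by lia.
rewrite (legendre_op_Lam_low (a := a) (b := b)); last by lia.
rewrite IHo; try lia.
have -> : (s - a.+1 - p = s - a - p.+1)%N by lia.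
rewrite factS !natrM -[a.+1%:R]natr1 -[p.+1%:R]natr1.
rewrite big_ord_recl [in RHS]big_ord_recr /=.
set Q1 := \prod_(i < p) _; set Q2 := \prod_(i < p) _.
have -> : Q2 = Q1 by apply: eq_bigr => i _; rewrite /bump -?natr1; ring.
have d3 : s%:R + 1 - 2 * (p%:R + 1) != 0 :> F.
  by apply: contraNneq d2 => d3; apply/eqP; rewrite -d3; ring.
rewrite /rec_coef !natrB ?natrM -?natr1 ?natrM; try lia.
rewrite /K' -natr1; field.
by rewrite d0 d1 d3.
Qed.

(** In the top grade only the leading part of the curve counts, and this is a
harmonic form of degree s + 1, which the power s of the quadric annihilates. *)
Lemma curve_op_Lam n a b : (n <= s.+1)%N ->
  (2 * a + b + 2 * (s.+1 - n) + n <= 2 * s)%N -> curve_op n Lam a b = 0.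
Proof.
move=> ns ab; rewrite /curve_op.
rewrite (@lines_op_lead _ _ (a + b + (s.+1 - n)) (2 * s - n)) ?size_iota; try lia; last first.
  by move=> a' b' _ ?; apply: legendre_op_Lam_low; lia.
have [lt|] := ltnP (2 * (a + (s.+1 - n)) + b + n) (2 * s).
  exact: legendre_op_Lam_low.
move=> ge; have {ge ab} ab : (2 * a + b + 2 * (s.+1 - n) + n = 2 * s)%N by lia.
have [p np] : exists p, n = (2 * p)%N \/ n = (2 * p).+1.
  by exists n./2; lia.
have [|K [He Ho]] := @legendre_op_Lam p; first by lia.
have ap : (p.-1 - a < p)%N by lia.
have iE : (p.-1 - a)%:R = p%:R - 1 - a%:R :> F.
  by rewrite natrB -1?[in RHS](@prednK p) -?natr1; [ring|lia|lia].
case: np => nE; rewrite nE in ns ab *.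
  rewrite He; last by lia.
  have z : s%:R - p%:R - (p.-1 - a)%:R - (a + (s.+1 - 2 * p))%:R = 0 :> F.
    by rewrite iE natrD natrB // -[s.+1%:R]natr1 natrM; ring.
  by rewrite (bigD1 (Ordinal ap)) //= z mul0r mulr0.
rewrite Ho; try lia.
have z : s%:R - p%:R - (p.-1 - a).+1%:R - (a + (s.+1 - (2 * p).+1))%:R = 0 :> F.
  by rewrite -natr1 iE natrD subSS natrB // natrM; ring.
by rewrite (bigD1 (Ordinal ap)) //= z mul0r mulr0.
Qed.

(** By induction on the degree: below degree s + 1 this is interpolation, and
from there on each monomial is the leading term of a multiple of one of the
curves, on which both functionals vanish. *)
Lemma cubature : exists S : seq (F * F * F), size S = 'C(s.+2, 2) /\
  forall a b, (2 * a + b <= 2 * s)%N -> nodal S a b = Lam a b.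
Proof.
have rsP j : exists rs : seq F, (j <= s)%N ->
    [/\ uniq rs, size rs = j.+1 & forall y, y \in rs -> (legendre_poly j%:R j.+1).[y] = 0].
  have [js|] := boolP (j <= s)%N; last by exists [::].
  have [|rs Hrs] := @favard_roots F (fun n => rec_coef n * (j%:R - n%:R)) (legendre_poly j%:R)
    erefl erefl (fun=> erefl) j; last by exists rs.
  move=> n nj; rewrite -natrB ?(ltnW nj) //.
  by rewrite /rec_coef !(mulr_gt0, invr_gt0) // ?ltr0n; lia.
have [rs rsE] : exists rs : nat -> seq F, forall j, (j <= s)%N ->
    [/\ uniq (rs j), size (rs j) = j.+1 & forall y, y \in rs j -> (legendre_poly j%:R j.+1).[y] = 0].
  have : forall n, exists rs : nat -> seq F, forall j, (j < n)%N -> (j <= s)%N ->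
    [/\ uniq (rs j), size (rs j) = j.+1 & forall y, y \in rs j -> (legendre_poly j%:R j.+1).[y] = 0].
    elim=> [|n [rs IH]]; first by exists (fun=> [::]).
    have [r Hr] := rsP n.
    exists (fun j => if j == n then r else rs j) => j jn js.
    case: eqVneq => [jE|jE]; last by apply: IH => //; lia.
    by rewrite jE; apply: Hr; rewrite -jE.
  by case/(_ s.+1) => rs Hrs; exists rs => j js; apply: Hrs.
have [||S [Ssz Sin SLam]] := @lines_interp F (fun j => j%:R) rs s.+1 Lam.
- move=> i j ij; rewrite -subr_eq0 -opprB oppr_eq0 -natrB ?pnatr_eq0; lia.
- by move=> j js; have [] := rsE j js.
exists S; split => //.
have Sl : on_lines S.
  move=> P /Sin [j [js Px Py]]; exists j; split => //.
  by have [_ _] := rsE j js; apply.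
move=> a b; move: {2}(a + b)%N (erefl (a + b)%N) => D.
elim/ltn_ind: D a b => D IH a b abD ab.
have [abs|abs] := leqP (a + b) s; first by rewrite SLam.
(* any n <= s + 1 with n <= b and s + 1 - n <= a would do *)
pose n := minn b s.+1.
pose del a b := nodal S a b - Lam a b.
have del0 a' b' : (a' + b' < D)%N -> (2 * a' + b' < (2 * s).+1)%N -> del a' b' = 0.
  by move=> lt le; rewrite /del (IH (a' + b')%N) ?subrr.
have : curve_op n del (a - (s.+1 - n)) (b - n) = 0.
  rewrite /curve_op (@eq_lines_op _ _ (fun a b => legendre_op n (nodal S) a b - legendre_op n Lam a b)); last first.
    by move=> *; exact: legendre_opB.
  by rewrite lines_opB -!/(curve_op _ _ _ _) curve_op_nodal // curve_op_Lam ?subrr // /n; lia.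
rewrite /curve_op (@lines_op_lead _ _ (D - n) ((2 * s).+1 - n)) ?size_iota; last 3 first.
- move=> a' b' h1 h2; rewrite (@legendre_op_lead _ _ D (2 * s).+1) //; try (rewrite /n in h1 h2 *; lia).
  by apply: del0; rewrite /n in h1 h2 *; lia.
- by rewrite /n; lia.
- by rewrite /n; lia.
rewrite (@legendre_op_lead _ _ D (2 * s).+1) //; try (rewrite /n; lia).
have -> : (a - (s.+1 - n) + (s.+1 - n) = a)%N by rewrite /n; lia.
have -> : (b - n + n = b)%N by rewrite /n; lia.
by move/eqP; rewrite subr_eq0 => /eqP.
Qed.

End Cubature.

(** * Upper bounds for the binary and the ternary quadric *)

Section Upper.
Variable R : realType.
Local Notation C := (Cplx R).

(** The coefficients are absorbed as roots of order d; in degree 0 this is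
impossible. *)
Lemma waring_weighted n d (T : Type) (S : seq T) (c : T -> C) (v : T -> 'I_n -> C) :
  (0 < d)%N -> waring_decomp d (\sum_(P <- S) c P *: linform (v P) ^+ d) (size S).
Proof.
move=> d0; case: S => [|P0 S']; first by exists (fun=> 0) => [i|]; rewrite ?big_nil ?big_ord0 ?rpred0.
set S := P0 :: S'.
exists (fun i : 'I_(size S) => d.-root (c (nth P0 S i)) *: linform (v (nth P0 S i))).
  by move=> i; apply: rpredZ; exact: linform_homog.
rewrite (big_nth P0) big_mkord; apply: eq_bigr => i _.
by rewrite exprZn rootCK.
Qed.

Lemma homog_apolarP n d (f g : {mpoly C[n]}) : f \is d.-homog -> g \is d.-homog ->
  (forall m, mdeg m = d -> apolar m f = apolar m g) -> f = g.
Proof.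
move=> fh gh e; apply/mpolyP => m.
have [md|md] := eqVneq (mdeg m) d; last by rewrite !(dhomog_nemf_coeff _ md).
exact: mulfI (mfact_neq0 C m) _ _ (e m md).
Qed.

Lemma apolar_weighted n d (T : Type) (S : seq T) (c : T -> C) (v : T -> 'I_n -> C) m :
  mdeg m = d -> apolar m (\sum_(P <- S) c P *: linform (v P) ^+ d) =
    d`!%:R * \sum_(P <- S) c P * \prod_i v P i ^+ m i.
Proof.
move=> md; rewrite apolar_sum mulr_sumr; apply: eq_bigr => P _.
by rewrite apolarZ apolar_linform // mulrCA.
Qed.

(** Interpolation at the roots of unity of order s + 1 prescribes the exponents
0, ..., s of the second variable, and periodicity gives those from s + 1 to 2 s:
there the prescribed value is the one at the exponent smaller by s + 1, which
is not s. *)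
Lemma waring_binary s : (0 < s)%N ->
  waring_decomp (2 * s) (('X_(inord 0) * 'X_(inord 1)) ^+ s : {mpoly C[2]}) s.+1.
Proof.
move=> s0.
have [rs rsE] := closed_field_poly_normal ('X^(s.+1) - 1 : {poly C}).
rewrite lead_coefDl ?size_polyN ?size_poly1 ?size_polyXn // lead_coefXn scale1r in rsE.
have rs_size : size rs = s.+1.
  have := size_prod_XsubC rs id; rewrite -rsE.
  by rewrite size_polyDl ?size_polyN ?size_poly1 ?size_polyXn // => -[].
have rs_uniq : uniq rs.
  by rewrite -separable_prod_XsubC -rsE separable_Xn_sub_1 // pnatr_eq0.
have rs1 y : y \in rs -> y ^+ s.+1 = 1.
  rewrite -root_prod_XsubC -rsE => /rootP.
  by rewrite hornerD hornerN hornerXn hornerC => /eqP; rewrite subr_eq0 => /eqP.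
pose K : C := (s`! * s`!)%:R / ((2 * s)`!)%:R.
have [w Hw] := line_interp (fun b => if b == s then K else 0) rs_uniq.
pose v (y : C) (i : 'I_2) := if i == inord 0 then 1 else y.
have -> : ('X_(inord 0) * 'X_(inord 1)) ^+ s = \sum_(y <- rs) w y *: linform (v y) ^+ (2 * s).
  have XE : ('X_(inord 0) * 'X_(inord 1)) ^+ s = 'X_[(U_(inord 0) + U_(inord 1)) *+ s] :> {mpoly C[2]}.
    by rewrite -mpolyXD mpolyXn.
  have mE : mdeg ((U_(inord 0) + U_(inord 1)) *+ s : 'X_{1..2}) = (2 * s)%N.
    by rewrite mdegMn mdegD !mdeg1.
  apply: (@homog_apolarP _ (2 * s)).
  - by rewrite XE dhomogX; apply/eqP.
  - by apply: (waring_homog (r := size rs)); apply: waring_weighted; rewrite muln_gt0.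
  move=> m md; rewrite apolar_weighted //.
  have md2 : (m (inord 0) + m (inord 1) = 2 * s)%N.
    rewrite -md mdegE !big_ord_recl big_ord0 addn0.
    by congr (m _ + m _)%N; apply: val_inj; rewrite /= inordK.
  have prod2 (G : 'I_2 -> C) : \prod_i G i = G (inord 0) * G (inord 1).
    rewrite !big_ord_recl big_ord0 mulr1.
    by congr (G _ * G _); apply: val_inj; rewrite /= inordK.
  have ne01 : (inord 1 == inord 0 :> 'I_2) = false.
    by apply/eqP=> /(congr1 val) /=; rewrite !inordK.
  have ->: \sum_(y <- rs) w y * \prod_i v y i ^+ m i = if m (inord 1) == s then K else 0.
    transitivity (\sum_(y <- rs) w y * y ^+ m (inord 1)).
      by apply: eq_bigr => y _; rewrite prod2 /v eqxx ne01 expr1n mul1r.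
    have [ms|ms] := leqP (m (inord 1)) s; first by rewrite Hw // rs_size.
    rewrite (gtn_eqF ms) -[RHS](_ : (if (m (inord 1) - s.+1 == s)%N then K else 0) = 0); last first.
      by case: eqP => //; lia.
    rewrite Hw; last by rewrite rs_size; lia.
    rewrite big_seq [RHS]big_seq; apply: eq_bigr => y /rs1 y1.
    by rewrite -{1}(subnKC ms) exprD y1 mul1r.
  rewrite XE /apolar mcoeffX; case: eqP => [<-|ne].
    rewrite mulr1 mulmnE mnmDE !mnm1E eqxx [inord 0 == _]eq_sym ne01 mul1n eqxx.
    rewrite (_ : (\prod_(i < 2) _)%N = (s`! * s`!)%N).
      by rewrite /K mulrC divfK // pnatr_eq0 -lt0n fact_gt0.
    rewrite !big_ord_recl big_ord0 muln1.
    by congr (_`! * _`!)%N; rewrite mulmnE mnmDE !mnm1E -!val_eqE /= !inordK // mul1n.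
  rewrite mulr0; case: eqP => [m1s|]; last by rewrite mulr0.
  case: ne; apply/mnmP => i; rewrite mulmnE mnmDE !mnm1E.
  have [->|i0] := eqVneq i (inord 0).
    by rewrite ne01 mul1n; lia.
  have -> : i = inord 1.
    apply: val_inj; rewrite /= inordK //; move: i0; rewrite -val_eqE /= inordK //.
    by case: i => -[|[|]].
  by rewrite eqxx mul1n m1s.
by rewrite -rs_size; apply: waring_weighted; rewrite muln_gt0.
Qed.

Lemma cvg_invSn_exp e : (0 < e)%N -> ((k.+1%:R^-1 : C) ^+ e) @[k --> \oo] --> (0 : C).
Proof.
move=> e0.
rewrite (_ : (fun k => _) = fun k : nat => \prod_(i < e) (k.+1%:R^-1 : C)); last first.
  by apply/funext => k; rewrite prodr_const card_ord.
rewrite (_ : nbhs (0 : C) = nbhs (\prod_(i < e) (0 : C))); last first.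
  by rewrite prodr_const card_ord expr0n -(prednK e0).
by apply: cvg_prod_seq => i _; exact: cvg_invSn.
Qed.

(** The torus acts on the nodes by (tau x, y, 1 / tau).  It multiplies the
coefficient of x^a y^b z^c by tau^(a - c), which is harmless for a = c, tends to
0 for a > c, and meets a zero of the cubature rule for a < c. *)
Lemma border_conic s : (0 < s)%N ->
  border_rk_le (2 * s) (conic C ^+ s) 'C(s.+2, 2).
Proof.
move=> s0.
have [S [S_size SL]] := cubature C s.
pose K : C := (2 ^ s * s`!)%:R / ((2 * s)`!)%:R.
pose tau (k : nat) : C := k.+1%:R^-1.
have tau0 k : tau k != 0 by rewrite invr_eq0 pnatr_eq0.
pose v k (P : C * C * C) (i : 'I_3) : C := [:: tau k * P.1.2; P.2; (tau k)^-1]`_i.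
pose u k := \sum_(P <- S) (P.1.1 * K) *: linform (v k P) ^+ (2 * s).
have uw k : waring_decomp (2 * s) (u k) 'C(s.+2, 2).
  by rewrite -S_size; apply: waring_weighted; rewrite muln_gt0.
exists u => [k|m]; first by exists 'C(s.+2, 2).
have ch : conic C ^+ s \is (2 * s).-homog.
  apply: dhomogMn; apply: rpredD; last apply: rpredZ.
    by rewrite mpolyXn dhomogX /= mdegMn mdeg1.
  by rewrite -mpolyXD dhomogX /= mdegD !mdeg1.
have [md|md] := eqVneq (mdeg m) (2 * s)%N; last first.
  rewrite (dhomog_nemf_coeff ch md) (_ : (fun k => _) = fun=> 0); first exact: cvg_cst.
  by apply/funext => k; exact: dhomog_nemf_coeff (waring_homog (uw k)) md.
pose M : C := (\prod_(i < 3) (m i)`!)%:R.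
have M0 : M != 0 by exact: mfact_neq0.
have mcE f : f@_m = M^-1 * apolar m f by rewrite /apolar mulKf.
rewrite mcE (_ : (fun k => _) = fun k => M^-1 * apolar m (u k)); last exact/funext.
apply: cvgMl_tmp.
have i0 : ord0 = inord 0 :> 'I_3 by apply: val_inj; rewrite /= inordK.
have i1 : lift ord0 ord0 = inord 1 :> 'I_3 by apply: val_inj; rewrite /= inordK.
have i2 : lift ord0 (lift ord0 ord0) = inord 2 :> 'I_3 by apply: val_inj; rewrite /= inordK.
have md3 : (m (inord 0) + m (inord 1) + m (inord 2))%N = (2 * s)%N.
  by rewrite -md mdegE !big_ord_recl big_ord0 addn0 addnA i2 i1 i0.
rewrite apolar_conic // /conic_mom.
set a := m (inord 0) in md3 *; set b := m (inord 1) in md3 *; set c := m (inord 2) in md3 *.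
have uE k : apolar m (u k) = (2 ^ s * s`!)%:R * (tau k ^+ a * (tau k)^-1 ^+ c) * nodal S a b.
  rewrite apolar_weighted // /nodal !mulr_sumr; apply: eq_bigr => P _.
  rewrite !big_ord_recl big_ord0 i2 i1 i0 /v !inordK //= -/a -/b -/c exprMn /K.
  have f0 : (2 * s)`!%:R != 0 :> C by rewrite pnatr_eq0 -lt0n fact_gt0.
  by field.
rewrite (_ : (fun k => _) = fun k => (2 ^ s * s`!)%:R * (tau k ^+ a * (tau k)^-1 ^+ c) * nodal S a b);
  last exact/funext.
have [ac|ca|ac] := ltngtP a c.
- rewrite SL /Lam; last by lia.
  rewrite ifF ?muln0; last by apply/eqP; lia.
  rewrite (_ : (fun k => _) = fun=> 0); first exact: cvg_cst.
  by apply/funext => k; rewrite mulr0.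
- rewrite muln0 (_ : (fun k => _) =
    fun k => (2 ^ s * s`!)%:R * nodal S a b * (tau k ^+ (a - c))).
    rewrite -[X in _ --> X](mulr0 ((2 ^ s * s`!)%:R * nodal S a b)).
    by apply: cvgMl_tmp; apply: cvg_invSn_exp; lia.
  by apply/funext => k; rewrite expfB // exprVn mulrAC.
- rewrite SL /Lam; last by lia.
  rewrite ifT; last by apply/eqP; lia.
  rewrite (_ : (fun k => _) = fun=> (2 ^ s * s`! * (a`! * gauss_mom b))%:R); first exact: cvg_cst.
  by apply/funext => k; rewrite -ac -exprMn divff // expr1n mulr1 [in RHS]natrM.
Qed.

End Upper.

(** * Diagonalisation of quadratic forms *)

Section Diag.
Variable F : numClosedFieldType.

Lemma sym_nonisotropic n (S : 'M[F]_n) : S^T = S -> S != 0 ->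
  exists v : 'rV_n, (v *m S *m v^T) 0 0 != 0.
Proof.
move=> St; apply: contraNP => /forallNP h.
have q0 (v : 'rV_n) : (v *m S *m v^T) 0 0 = 0 by apply/eqP; apply: contrapT => /negP; exact: h.
have qd i j : ((delta_mx 0 i : 'rV_n) *m S *m (delta_mx 0 j : 'rV_n)^T) 0 0 = S i j.
  by rewrite -rowE trmx_delta -colE !mxE.
apply/eqP/matrixP => i j; rewrite mxE.
have mE (A B : 'M[F]_1) : (A + B) 0 0 = A 0 0 + B 0 0 by rewrite mxE.
have := q0 (delta_mx 0 i + delta_mx 0 j).
rewrite linearD /= !mulmxDl !mulmxDr !mE !q0 !qd add0r addr0.
have -> : S j i = S i j by rewrite -[in LHS]St mxE.
by rewrite -mulr2n => /eqP; rewrite mulrn_eq0 => /eqP.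
Qed.

(** Subtracting the square of the linear form [v S], scaled to agree with S on v,
adds v to the kernel and keeps what was there. *)
Lemma sym_gram n k (S : 'M[F]_n) : (\rank S <= k)%N -> S^T = S ->
  exists E : 'M[F]_(k, n), S = E^T *m E.
Proof.
elim: k S => [|k IH] S rS St.
  exists 0; rewrite mulmx0; apply/eqP; rewrite -mxrank_eq0; lia.
have [->|S0] := eqVneq S 0; first by exists 0; rewrite mulmx0.
have [v vS] := sym_nonisotropic St S0.
set q := (v *m S *m v^T) 0 0 in vS.
have qE : v *m S *m v^T = q%:M by rewrite [LHS]mx11_scalar.
pose e := (sqrtC q)^-1 *: (v *m S).
have eT : e^T = (sqrtC q)^-1 *: (S *m v^T).
  by rewrite /e linearZ /= trmx_mul St.
have eE : e^T *m e = q^-1 *: (S *m v^T *m (v *m S)).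
  rewrite eT /e -scalemxAl -scalemxAr scalerA -invfM -expr2 sqrtCK //.
pose S1 := S - e^T *m e.
have S1t : S1^T = S1 by rewrite /S1 linearB /= trmx_mul trmxK St.
have vS1 : v *m S1 = 0.
  rewrite /S1 mulmxBr eE -scalemxAr !mulmxA qE -mulmxA mul_scalar_mx scalerA mulVf // scale1r.
  by rewrite subrr.
have kS : (kermx S < kermx S1)%MS.
  rewrite /ltmx; apply/andP; split.
    apply/sub_kermxP; rewrite /S1 mulmxBr eE -scalemxAr !mulmxA mulmx_ker !mul0mx scaler0.
    by rewrite subrr.
  apply/negP => /(submx_trans (introT (sub_kermxP) vS1)) /sub_kermxP vS0.
  by move: vS; rewrite /q vS0 mul0mx mxE eqxx.
have rS1 : (\rank S1 <= k)%N.
  have := rank_ltmx kS; rewrite !mxrank_ker.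
  have := rank_leq_row S; have := rank_leq_row S1; lia.
have [E1 E1E] := IH S1 rS1 S1t.
have colE : (col_mx e E1)^T *m col_mx e E1 = S.
  by rewrite tr_col_mx mul_row_col -E1E /S1 addrC subrK.
by exists (col_mx e E1).
Qed.

Lemma quad_mcoeff n (g : {mpoly F[n]}) : g \is 2.-homog ->
  g = \sum_i \sum_j (apolar (U_(i) + U_(j)) g / 2) *: ('X_i * 'X_j).
Proof.
move=> gh; apply/mpolyP => m.
pose h i j := apolar (U_(i) + U_(j)) g / 2.
have hC i j : h i j = h j i by rewrite /h addmC.
have [md|md] := eqVneq (mdeg m) 2%N; last first.
  rewrite (dhomog_nemf_coeff gh md) raddf_sum big1 // => i _ /=.
  rewrite raddf_sum big1 // => j _ /=.
  rewrite mcoeffZ -mpolyXD mcoeffX; case: ((U_(i) + U_(j))%MM =P m) md => [<-|_ _]; last by rewrite mulr0.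
  by rewrite mdegD !mdeg1.
have [a ma] : exists a, (0 < m a)%N.
  apply/existsP; apply: contra_eqT md; rewrite negb_exists => /forallP h0.
  by rewrite mdegE big1 // => i _; move: (h0 i); lia.
have /eqP/mdeg1P [b /eqP mb] : mdeg (m - U_(a)) = 1%N.
  by apply: succn_inj; rewrite mdegBU.
have mE : m = (U_(a) + U_(b))%MM.
  by rewrite -mb addmC submUK.
apply: (mulfI (mfact_neq0 F m)); rewrite -/(apolar m g) -/(apolar m (\sum_i _)).
rewrite apolar_sum.
have s1 (c : 'I_n) (G : 'I_n -> F) : \sum_i ((U_(c)%MM : 'X_{1..n}) i)%:R * G i = G c.
  rewrite (bigD1 c) //= mnm1E eqxx mul1r big1 ?addr0 // => i ic.
  by rewrite mnm1E eq_sym (negPf ic) mul0r.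
transitivity (\sum_i (m i)%:R * \sum_j ((m - U_(i))%MM j)%:R * h i j); last first.
  apply: eq_bigr => i _; rewrite apolar_sum mulr_sumr; apply: eq_bigr => j _.
  rewrite apolarZ apolarXM -/(h i j) -['X_j]mulr1 apolarXM.
  have [i0|i0] := posnP (m i); first by rewrite i0 !mul0r mulr0.
  have [j0|j0] := posnP ((m - U_(i))%MM j); first by rewrite j0 !mul0r !mulr0.
  rewrite apolar1 ?mulr1; last by apply: succn_inj; apply: succn_inj; rewrite !mdegBU.
  by rewrite /h; ring.
rewrite (eq_bigr (fun i => ((U_(a)%MM : 'X_{1..n}) i)%:R * (\sum_j ((m - U_(i))%MM j)%:R * h i j)
   + ((U_(b)%MM : 'X_{1..n}) i)%:R * (\sum_j ((m - U_(i))%MM j)%:R * h i j))); last first.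
  by move=> i _; rewrite -mulrDl -natrD -mnmDE -mE.
rewrite big_split /= !s1.
have -> : (m - U_(a) = U_(b))%MM by [].
have -> : (m - U_(b) = U_(a))%MM by rewrite mE addmK.
by rewrite !s1 (hC b a) /h -mE; field.
Qed.

Lemma quad_diag n (g : {mpoly F[n]}) : g \is 2.-homog ->
  exists k, exists2 E : 'M[F]_(k, n), row_free E & g = \sum_i linform (E i) ^+ 2.
Proof.
move=> gh; pose S : 'M[F]_n := \matrix_(i, j) (apolar (U_(i) + U_(j)) g / 2).
have St : S^T = S by apply/matrixP => i j; rewrite !mxE addmC.
have [E SE] := sym_gram (leqnn _) St.
exists (\rank S), E.
  rewrite /row_free eqn_leq rank_leq_row /= {1}SE; exact: mxrankM_maxr.
rewrite {1}(quad_mcoeff gh).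
transitivity (\sum_i \sum_j \sum_k (E k i * E k j) *: ('X_i * 'X_j : {mpoly F[n]})).
  apply: eq_bigr => i _; apply: eq_bigr => j _; rewrite -scaler_suml; congr (_ *: _).
  move/matrixP/(_ i j): SE; rewrite !mxE => ->.
  by apply: eq_bigr => k _; rewrite mxE.
transitivity (\sum_k \sum_i \sum_j (E k i * E k j) *: ('X_i * 'X_j : {mpoly F[n]})).
  rewrite [RHS]exchange_big; apply: eq_bigr => i _; exact: exchange_big.
apply: eq_bigr => k _; rewrite expr2 /linform mulr_suml; apply: eq_bigr => i _.
rewrite mulr_sumr; apply: eq_bigr => j _.
by rewrite -scalerAl -scalerAr scalerA.
Qed.
End Diag.

(** * Rank and border rank of powers of quadratic forms *)

Lemma minimum_eq (P : set nat) N : P N -> (forall k, P k -> (N <= k)%N) -> minimum P = N.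
Proof.
move=> PN min_N; have [Pm mN] := minimumP PN.
by apply/eqP; rewrite eqn_leq mN min_N.
Qed.

Lemma big_ord3 (V : nmodType) (G : 'I_3 -> V) :
  \sum_i G i = G (inord 0) + G (inord 1) + G (inord 2).
Proof.
rewrite !big_ord_recl big_ord0 addr0 addrA.
by congr (G _ + G _ + G _); apply: val_inj; rewrite /= inordK.
Qed.

Section Main.
Variable R : realType.
Local Notation C := (Cplx R).

Lemma size_monos k s : size (monos k.+1 s) = 'C(s + k, k).
Proof. by rewrite size_basis -[in RHS](bin_sub (leq_addl s k)) addnK. Qed.

(** A right inverse of the coefficient matrix substitutes new variables for the
linear forms. *)
Lemma border_gram n k (E : 'M[C]_(k.+1, n)) s r : row_free E ->
  border_rk_le (2 * s) ((\sum_i linform (E i) ^+ 2) ^+ s) r -> ('C(s + k, k) <= r)%N.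
Proof.
move=> /row_freeP [B EB].
pose t := [tuple linform (B j) | j < n].
have th i : tnth t i \is 1.-homog by rewrite tnth_mktuple; exact: linform_homog.
move=> /(border_comp th).
have -> : ((\sum_i linform (E i) ^+ 2) ^+ s) \mPo t = sumsq C k.+1 ^+ s.
  rewrite rmorphXn; congr (_ ^+ s); rewrite raddf_sum; apply: eq_bigr => i _ /=.
  rewrite rmorphXn; congr (_ ^+ 2) => /=; rewrite linform_comp.
  transitivity (\sum_l (E *m B) i l *: ('X_l : {mpoly C[k.+1]})).
    under eq_bigr => j _ do rewrite tnth_mktuple /linform scaler_sumr.
    rewrite exchange_big; apply: eq_bigr => l _ /=.
    rewrite mxE scaler_suml; apply: eq_bigr => j _.
    by rewrite scalerA.
  rewrite EB (bigD1 i) //= mxE eqxx scale1r big1 ?addr0 // => l li.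
  by rewrite mxE eq_sym (negPf li) scale0r.
by move=> /border_sumsq; rewrite size_monos.
Qed.

Lemma waring_exp0 n (f : {mpoly C[n]}) : waring_decomp (2 * 0) (f ^+ 0) 1.
Proof. by exists (fun=> 0) => [i|]; rewrite ?rpred0 // big_ord1 !expr0. Qed.

Lemma waring_sumsq2 n (E : 'M[C]_(2, n)) s :
  waring_decomp (2 * s) ((\sum_i linform (E i) ^+ 2) ^+ s) s.+1.
Proof.
case: s => [|s]; first exact: waring_exp0.
pose u := linform (E 0) + 'i *: linform (E 1); pose v := linform (E 0) - 'i *: linform (E 1).
have uh : u \is 1.-homog by apply: rpredD; last apply: rpredZ; exact: linform_homog.
have vh : v \is 1.-homog by apply: rpredB; last apply: rpredZ; exact: linform_homog.
have th i : tnth [tuple u; v] i \is 1.-homog by case: i => -[|[|]].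
have e0 : 'X_(inord 0) \mPo [tuple u; v] = u by rewrite comp_mpolyXU inordK.
have e1 : 'X_(inord 1) \mPo [tuple u; v] = v by rewrite comp_mpolyXU inordK.
have := waring_comp th (waring_binary R (ltn0Sn s)).
rewrite rmorphXn rmorphM /= e0 e1.
have -> : u * v = linform (E 0) ^+ 2 + linform (E 1) ^+ 2.
  by rewrite mulrC -subr_sqr exprZn sqrCi scaleN1r opprK.
by rewrite big_ord_recl big_ord1 (_ : lift _ _ = 1) //; apply: val_inj.
Qed.

Lemma border_sumsq3 n (E : 'M[C]_(3, n)) s :
  border_rk_le (2 * s) ((\sum_i linform (E i) ^+ 2) ^+ s) 'C(s.+2, 2).
Proof.
case: s => [|s]; first by apply: rk_le_border; exists 1%N => //; exact: waring_exp0.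
pose i0 : 'I_3 := inord 0; pose i1 : 'I_3 := inord 1; pose i2 : 'I_3 := inord 2.
pose u := (2^-1 : C) *: (linform (E i0) + 'i *: linform (E i1)).
pose v := linform (E i0) - 'i *: linform (E i1).
pose t := [tuple u; linform (E i2); v].
have uh : u \is 1.-homog.
  by apply: rpredZ; apply: rpredD; last apply: rpredZ; exact: linform_homog.
have vh : v \is 1.-homog by apply: rpredB; last apply: rpredZ; exact: linform_homog.
have th i : tnth t i \is 1.-homog by case: i => -[|[|[|]]] // ?; exact: linform_homog.
have e0 : 'X_(inord 0) \mPo t = u by rewrite comp_mpolyXU inordK.
have e1 : 'X_(inord 1) \mPo t = linform (E i2) by rewrite comp_mpolyXU inordK.
have e2 : 'X_(inord 2) \mPo t = v by rewrite comp_mpolyXU inordK.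
have := border_comp th (border_conic R (ltn0Sn s)).
have -> : (conic C ^+ s.+1) \mPo t = (\sum_i linform (E i) ^+ 2) ^+ s.+1; last by [].
rewrite rmorphXn /=; congr (_ ^+ _).
rewrite /conic raddfD /= comp_mpolyZ rmorphXn rmorphM /= e0 e1 e2.
have -> : 2 *: (u * v) = linform (E i0) ^+ 2 + linform (E i1) ^+ 2.
  rewrite -scalerAl scalerA divff ?scale1r; last by rewrite pnatr_eq0.
  by rewrite mulrC -subr_sqr exprZn sqrCi scaleN1r opprK.
by rewrite addrC big_ord3 addrAC.
Qed.

(** For s = 1 the lower bound for the border rank is k + 1. *)
Lemma rk_gram n k (E : 'M[C]_(k.+1, n)) : row_free E ->
  rk 2 (\sum_i linform (E i) ^+ 2) = k.+1.
Proof.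
move=> Efree; apply: minimum_eq.
  by exists (fun i => linform (E i)) => // i; exact: linform_homog.
move=> r gr; have := @border_gram _ _ E 1 r Efree; rewrite expr1 add1n binSn; apply.
by apply: rk_le_border; exists r.
Qed.

Lemma rk_brk_eq n d (f : {mpoly C[n]}) N : waring_decomp d f N ->
  (forall r, border_rk_le d f r -> (N <= r)%N) -> brk d f = N /\ rk d f = N.
Proof.
move=> fN minN; split; apply: minimum_eq => //.
  by apply: rk_le_border; exists N.
by move=> r fr; apply: minN; apply: rk_le_border; exists r.
Qed.
End Main.

Theorem theorem4p5 (R : realType) (g : {mpoly (Cplx R)[3]}) (s : nat)
    (g_quadratic : g \is 2.-homog) (g_neq0 : g <> 0) :
  ((rk 2 g < 3)%N ->
     brk (2 * s) (g ^+ s) = rk (2 * s) (g ^+ s) /\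
     rk (2 * s) (g ^+ s) = 'C(s + rk 2 g - 1, rk 2 g - 1)) /\
  (~ (rk 2 g < 3)%N ->
     brk (2 * s) (g ^+ s) = 'C(s + 2, 2) /\
     'C(s + 2, 2) = ((s + 1) * (s + 2) %/ 2)%N).
Proof.
have [[|k] [E Efree gE]] := quad_diag g_quadratic.
  by case: g_neq0; rewrite gE big_ord0.
have k3 : (k < 3)%N by have := rank_leq_col E; rewrite (eqP Efree).
have lower := fun r => @border_gram R 3 k E s r Efree.
rewrite gE rk_gram // (addnS s k) !subn1 /=.
split=> [k2|k2].
  suff [-> ->] : brk (2 * s) ((\sum_i linform (E i) ^+ 2) ^+ s) = 'C(s + k, k) /\
         rk (2 * s) ((\sum_i linform (E i) ^+ 2) ^+ s) = 'C(s + k, k) by [].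
  apply: rk_brk_eq => //.
  case: k => [|[|k]] // in E Efree gE k3 k2 lower *.
    rewrite bin0; exists (fun=> linform (E 0)) => [_|]; first exact: linform_homog.
    by rewrite !big_ord1 exprM.
  by rewrite addn1 bin1; exact: waring_sumsq2.
have {k2 k3} k2 : k = 2%N by lia.
case: _ / (esym k2) in E Efree gE lower *.
split.
  apply: minimum_eq => [|r]; last exact: lower.
  by rewrite addn2; exact: border_sumsq3.
by rewrite addn2 addn1 bin2 /= divn2 mulnC.
Qed.
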